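(* Let $T$ be a string of length $n$ over an alphabet $\Sigma$ of size $\sigma\ge 2$. For any $1\le i\le j<n$, $|\mathsf{MUS}(T[i..j+1])\bigtriangleup\mathsf{MUS}(T[i..j])|\le 4$ and $-1\le|\mathsf{MUS}(T[i..j+1])|-|\mathsf{MUS}(T[i..j])|\le 2$. Furthermore, these bounds are tight: for any $\sigma\ge 3$ and any $i,j$ with $1\le i\le j<n$ and $j-i+1\ge 5$, there exist strings $T$ over an alphabet of size $\sigma$ attaining $|\mathsf{MUS}(T[i..j+1])\bigtriangleup\mathsf{MUS}(T[i..j])|=4$, strings attaining $|\mathsf{MUS}(T[i..j+1])|-|\mathsf{MUS}(T[i..j])|=2$, and strings attaining $|\mathsf{MUS}(T[i..j+1])|-|\mathsf{MUS}(T[i..j])|=-1$.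
   Context: $T[a..b]$ denotes the substring of $T$ from position $a$ to $b$. For a string $S$ and a string $w$, $\#\mathit{occ}_S(w)$ is the number of positions at which $w$ occurs in $S$; by convention $\#\mathit{occ}_S(\varepsilon)=|S|+1$. A substring $w$ of $S$ is unique in $S$ if $\#\mathit{occ}_S(w)=1$ and repeating in $S$ if $\#\mathit{occ}_S(w)\ge 2$. For $1\le i\le j\le n$, $\mathsf{MUS}(T[i..j])$ is the set of intervals $[s,t]$ (positions in $T$) with $i\le s\le t\le j$ such that $T[s..t]$ is unique in $T[i..j]$ and every proper substring of $T[s..t]$ (including the empty string) is repeating in $T[i..j]$. $\bigtriangleup$ denotes symmetric difference. *)

(* Defs.v *)
From mathcomp Require Import all_boot all_order all_algebra.
Set Implicit Arguments. Unset Strict Implicit. Unset Printing Implicit Defensive.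

(* Strings are sequences over an eqType alphabet; positions are 1-indexed. *)

(* T[a..b] (1-indexed, inclusive); empty if b < a. *)
Definition substr (A : eqType) (T : seq A) (a b : nat) : seq A :=
  take (b.+1 - a) (drop a.-1 T).

(* #occ_S(w): number of positions p (0-indexed) at which w occurs in S.
   For w = [::] this is size S + 1, matching the convention. *)
Definition occ (A : eqType) (S w : seq A) : nat :=
  count (fun p => (p + size w <= size S) && (take (size w) (drop p S) == w))
        (iota 0 (size S).+1).

Definition unique_in (A : eqType) (S w : seq A) : bool := occ S w == 1.
Definition repeating_in (A : eqType) (S w : seq A) : bool := 2 <= occ S w.

Definition proper_subs_repeating (A : eqType) (S w : seq A) : bool :=
  [forall k : 'I_(size w).+1, forall l : 'I_(size w).+1,
     (take l (drop k w) != w) ==> repeating_in S (take l (drop k w))].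

Definition isMUS (A : eqType) (T : seq A) (i j s t : nat) : bool :=
  [&& i <= s, s <= t, t <= j,
      unique_in (substr T i j) (substr T s t)
    & proper_subs_repeating (substr T i j) (substr T s t)].

(* MUS(T[i..j]) as a finite set of intervals [s,t] of positions of T
   (positions range over 0..|T|, which contains all 1 <= s <= t <= |T|). *)
Definition MUS (A : eqType) (T : seq A) (i j : nat)
  : {set 'I_(size T).+1 * 'I_(size T).+1} :=
  [set p : 'I_(size T).+1 * 'I_(size T).+1 | isMUS T i j p.1 p.2].

Definition symdiff (X : finType) (P Q : {set X}) : {set X} :=
  (P :\: Q) :|: (Q :\: P).

(* Main.v *)
(** Let S be the window T[i..j] and Sc its extension by the letter T[j+1].
    Call an interval collapsed if it is unique in S but not in Sc.  Its content
    is then a suffix of Sc, so any two collapsed contents are suffixes of one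
    another, and uniqueness in S makes all collapsed intervals end at the same
    position e.  A deleted MUS is collapsed, and at most one MUS ends at a given
    position, so at most one MUS is deleted.  An added MUS [s,t] with t <= j
    has a collapsed maximal proper subinterval, so t is e or e + 1, and the MUS
    of S inside that subinterval is deleted.  Hence at most three MUSs are
    added, and at most one if none is deleted.  Tightness is reached by
    a^p b c c followed by b (which adds ab, bc and cb, and deletes b) and by
    a b b c^p a followed by b (which only deletes ab). *)

Require Import Defs.
From mathcomp Require Import all_boot all_order all_algebra.
From mathcomp Require Import zify.
Import GRing.Theory Num.Theory.

(** * Slices, counts and set differences *)

Lemma drop_take (T : Type) (s : seq T) m k :
  drop k (take m s) = take (m - k) (drop k s).
Proof.
by elim: s m k => [|x s IH] [|m] [|k] //=; rewrite ?sub0n ?take0 ?IH ?subSS.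
Qed.

Lemma count_eq1P (T : eqType) (a : pred T) (s : seq T) (x : T) :
  uniq s -> x \in s -> a x ->
  reflect (forall y, y \in s -> a y -> y = x) (count a s == 1).
Proof.
move=> us xs ax; apply: (iffP eqP) => [c1 y ys ay|H].
  have := c1; rewrite -size_filter.
  have: x \in filter a s by rewrite mem_filter ax.
  have: y \in filter a s by rewrite mem_filter ay.
  by case: (filter a s) => [|z [|]] //; rewrite !inE => /eqP-> /eqP->.
rewrite (@eq_in_count _ _ (pred1 x)) ?count_uniq_mem ?xs // => y ys /=.
by apply/idP/eqP => [/(H _ ys)|->].
Qed.

Lemma card_symdiff (X : finType) (P Q : {set X}) :
  #|symdiff P Q| = #|P :\: Q| + #|Q :\: P|.
Proof.
rewrite /symdiff cardsU; have -> : (P :\: Q) :&: (Q :\: P) = set0.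
  by apply/setP => x; rewrite !inE; case: (x \in P); case: (x \in Q).
by rewrite cards0 subn0.
Qed.

Lemma card_setD_balance (X : finType) (P Q : {set X}) :
  #|P| + #|Q :\: P| = #|Q| + #|P :\: Q|.
Proof. by rewrite -(cardsID Q P) -(cardsID P Q) setIC addnAC. Qed.

(** * Uniqueness and minimality by positions, in a window that starts at [i] *)

Section UniqueIntervals.

Variables (A : eqType) (x0 : A) (T : seq A) (i : nat).

Definition letter k := nth x0 T k.-1.

Definition occurs_at p s l :=
  all (fun k => letter (p + k) == letter (s + k)) (iota 0 l).

(* Indexed by length rather than by end position, so that l = 0 makes sense. *)
Definition unique_at j s l :=
  all (fun p => occurs_at p s l ==> (p == s)) (index_iota i (j.+2 - l)).

Lemma occurs_atP p s l :
  reflect (forall k, k < l -> letter (p + k) = letter (s + k))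
          (occurs_at p s l).
Proof.
apply: (iffP allP) => H k.
  by move=> kl; apply/eqP/H; rewrite mem_iota.
by rewrite mem_iota /= add0n => kl; apply/eqP/H.
Qed.

Lemma unique_atP j s l :
  reflect (forall p, i <= p -> p + l <= j.+1 -> occurs_at p s l -> p = s)
          (unique_at j s l).
Proof.
apply: (iffP allP) => H p.
  move=> ip pl o; apply/eqP; move: (H p); rewrite o; apply.
  by rewrite mem_index_iota; lia.
by rewrite mem_index_iota => pr; apply/implyP => o; apply/eqP/H => //; lia.
Qed.

Lemma occurs_at_sub p s l d m : d + m <= l ->
  occurs_at p s l -> occurs_at (p + d) (s + d) m.
Proof.
move=> dm /occurs_atP o; apply/occurs_atP => k km.
by rewrite -!addnA; apply: o; lia.
Qed.

(** An occurrence of the longer factor at [p] carries one of the inner factor at [p + (s' - s)]. *)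
Lemma unique_at_mono j s l s' l' : s <= s' -> s' + l' <= s + l ->
  unique_at j s' l' -> unique_at j s l.
Proof.
move=> ss sl /unique_atP u; apply/unique_atP => p ip pl o.
suff: p + (s' - s) = s' by lia.
apply: u; [lia | lia |].
have := @occurs_at_sub p s l (s' - s) l' _ o; rewrite subnKC //; apply; lia.
Qed.

Lemma unique_at_shrink j s l : unique_at j.+1 s l -> unique_at j s l.
Proof. by move=> /unique_atP u; apply/unique_atP => p ip pl; apply: u; lia. Qed.

Lemma unique_at0 j s : i <= j -> unique_at j s 0 = false.
Proof.
move=> ij; apply/negP => /unique_atP u.
have := u i (leqnn _) _ _; have := u i.+1 (leqnSn _) _ _.
by rewrite /occurs_at /= => /(_ _ isT) h /(_ _ isT) h'; lia.
Qed.

(** The only start that the larger window adds for length [l] is [j.+2 - l], so the new occurrence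
    sits there. *)
Lemma collapsed_occurs_at j s l : unique_at j s l -> ~~ unique_at j.+1 s l ->
  i <= s -> s + l <= j.+1 -> occurs_at (j.+2 - l) s l.
Proof.
move=> /unique_atP u nu is_ sl; apply: contraR nu => no.
apply/unique_atP => p ip pl o; apply: u => //.
suff: p <> j.+2 - l by lia.
by move=> pe; rewrite -pe o in no.
Qed.

(* Both factors recur as suffixes of the extended window, so the shorter one
   is a suffix of the longer one and hence also ends where the longer one does. *)
Lemma collapsed_same_end j s l s' l' :
  unique_at j s l -> ~~ unique_at j.+1 s l -> i <= s -> s + l <= j.+1 ->
  unique_at j s' l' -> ~~ unique_at j.+1 s' l' -> i <= s' -> s' + l' <= j.+1 ->
  s + l = s' + l'.
Proof.
wlog ll : s l s' l' / l <= l'.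
  move=> W; case: (leqP l l') => ll; first exact: W.
  by move=> *; apply/esym; apply: W => //; apply: ltnW.
move=> u nu is_ sl u' nu' is' sl'.
have /occurs_atP o := collapsed_occurs_at _ _ _ u nu is_ sl.
have /occurs_atP o' := collapsed_occurs_at _ _ _ u' nu' is' sl'.
suff: s' + (l' - l) = s by lia.
apply: (unique_atP _ _ _ u); [lia | lia |].
apply/occurs_atP => k kl; rewrite -o // -addnA -o'; last by lia.
by congr letter; lia.
Qed.

(** Every proper factor lies in one of the two obtained by removing the last or the first letter, so
    by [unique_at_mono] these two decide minimality. *)
Definition minimal_unique j s t :=
  [&& i <= s, s <= t, t <= j, unique_at j s (t.+1 - s),
      ~~ unique_at j s (t - s) & ~~ unique_at j s.+1 (t - s)].

Lemma minimal_uniqueP j s t :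
  reflect [/\ [/\ i <= s, s <= t & t <= j], unique_at j s (t.+1 - s),
      ~~ unique_at j s (t - s) & ~~ unique_at j s.+1 (t - s)]
    (minimal_unique j s t).
Proof.
rewrite /minimal_unique; apply: (iffP idP).
  by case/and5P=> ? ? ? ? /andP[? ?]; split.
by case=> -[-> -> ->] -> -> ->.
Qed.

(** If the starts differed, the shorter interval would lie in the longer one minus its first letter,
    which is not unique. *)
Lemma minimal_unique_inj j s s' t :
  minimal_unique j s t -> minimal_unique j s' t -> s = s'.
Proof.
wlog ss : s s' / s < s'.
  move=> W m m'; case: (ltngtP s s') => // ss; first exact: W m m'.
  by apply/esym; apply: W m' m.
move=> /minimal_uniqueP[[? ? ?] _ _ /negP n] /minimal_uniqueP[[? ? ?] u _ _].
by case: n; apply: unique_at_mono u; lia.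
Qed.

(** Letters are stripped from either end while uniqueness survives; [unique_at0] stops this before
    the factor is empty. *)
Lemma exists_minimal_unique j s l : i <= j -> i <= s -> s + l <= j.+1 ->
  unique_at j s l ->
  exists s' t', [/\ s <= s', t' < s + l & minimal_unique j s' t'].
Proof.
move=> ij; elim: l s => [|l IH] s is_ sl u; first by rewrite unique_at0 in u.
case: (boolP (unique_at j s l)) => [u1|nu1].
  have [||s' [t' [? ? ?]]] := IH s _ _ u1; rewrite ?is_ //; first by lia.
  by exists s', t'; split=> //; lia.
case: (boolP (unique_at j s.+1 l)) => [u2|nu2].
  have [||s' [t' [? ? ?]]] := IH s.+1 _ _ u2; [by lia|by lia|].
  by exists s', t'; split=> //; lia.
exists s, (s + l); split=> //; first by lia.
apply/minimal_uniqueP; rewrite -addnS !addKn; split=> //; split; lia.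
Qed.

(** A larger window keeps repeated factors repeated, so minimality can only be lost together with
    uniqueness. *)
Lemma deleted_not_unique j s t :
  minimal_unique j s t -> ~~ minimal_unique j.+1 s t ->
  ~~ unique_at j.+1 s (t.+1 - s).
Proof.
move=> /minimal_uniqueP[[? ? ?] u n1 n2]; apply: contra => u'.
apply/minimal_uniqueP; split=> //; first by split=> //; lia.
  by apply: contra n1; apply: unique_at_shrink.
by apply: contra n2; apply: unique_at_shrink.
Qed.

(** The interval is already unique in the smaller window, so there one of its two maximal proper
    factors is unique too. As [s' + l'] is one past the last position, removing the last letter
    gives [t] and removing the first gives [t.+1]. *)
Lemma added_collapsed j s t : t <= j ->
  minimal_unique j.+1 s t -> ~~ minimal_unique j s t ->
  exists s' l', [/\ i <= s', (s' + l' == t) || (s' + l' == t.+1),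
    unique_at j s' l' & ~~ unique_at j.+1 s' l'].
Proof.
move=> tj /minimal_uniqueP[[? ? ?] u n1 n2] nm.
case: (boolP (unique_at j s (t - s))) => [u1|nu1].
  by exists s, (t - s); split=> //; lia.
case: (boolP (unique_at j s.+1 (t - s))) => [u2|nu2].
  by exists s.+1, (t - s); split=> //; lia.
case/negP: nm; apply/minimal_uniqueP; split=> //.
exact: unique_at_shrink.
Qed.

(** Had the MUS inside survived, monotonicity would keep the outer interval unique. *)
Lemma collapsed_deleted j s l : i <= j -> i <= s -> s + l <= j.+1 ->
  unique_at j s l -> ~~ unique_at j.+1 s l ->
  exists s' t', minimal_unique j s' t' && ~~ minimal_unique j.+1 s' t'.
Proof.
move=> ij is_ sl u nu.
have [s' [t' [ss tt m]]] := exists_minimal_unique _ _ _ ij is_ sl u.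
exists s', t'; rewrite m /=; apply: contra nu.
by move=> /minimal_uniqueP[[? ? ?] u' _ _]; apply: unique_at_mono u'; lia.
Qed.

Lemma added_end j s t s0 t0 :
  minimal_unique j s0 t0 -> ~~ minimal_unique j.+1 s0 t0 ->
  minimal_unique j.+1 s t -> ~~ minimal_unique j s t ->
  [|| t == j.+1, t == t0 | t == t0.+1].
Proof.
move=> m0 n0 m n; have nu0 := deleted_not_unique _ _ _ m0 n0.
case/minimal_uniqueP: m0 => [[? ? ?] u0 _ _].
case: (leqP t j) => tj; last first.
  by case/minimal_uniqueP: m => [[? ? ?] _ _ _]; lia.
have [s' [l' [? ? u' nu']]] := added_collapsed _ _ _ tj m n.
(* The deleted interval is itself collapsed, so the two ends agree. *)
suff: s0 + (t0.+1 - s0) = s' + l' by lia.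
apply: (collapsed_same_end j) => //; lia.
Qed.

(** * Agreement with the definitions on strings *)

Section Window.

Variable j : nat.
Hypotheses (i_gt0 : 0 < i) (ij : i <= j) (jT : j <= size T).

(** Offset [p - i] in the window, counted from 0, is position [p] of the text, counted from 1. *)
Lemma occurrence_eq p s l : i <= s -> i <= p ->
  s + l <= j.+1 -> p + l <= j.+1 ->
  (take l (drop (p - i) (substr T i j)) == take l (drop s.-1 T))
  = occurs_at p s l.
Proof.
move=> is_ ip sl pl.
have -> : take l (drop (p - i) (substr T i j)) = take l (drop p.-1 T).
  rewrite /substr drop_take take_takel; last by lia.
  by rewrite drop_drop; congr (take _ (drop _ _)); lia.
have sz q : i <= q -> q + l <= j.+1 -> size (take l (drop q.-1 T)) = l.
  by move=> *; rewrite size_takel // size_drop; lia.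
have nthE q k : 0 < q -> k < l ->
    nth x0 (take l (drop q.-1 T)) k = letter (q + k).
  by move=> *; rewrite nth_take // nth_drop /letter; congr nth; lia.
apply/eqP/occurs_atP => [e k kl|o].
  by rewrite -!nthE ?e //; lia.
apply: (@eq_from_nth _ x0); first by rewrite !sz.
by move=> k; rewrite sz // => kl; rewrite !nthE ?o //; lia.
Qed.

Lemma size_window : size (substr T i j) = j.+1 - i.
Proof. by rewrite size_takel // size_drop; lia. Qed.

Lemma unique_inE s l : i <= s -> s + l <= j.+1 ->
  (unique_in (substr T i j) (take l (drop s.-1 T)) = unique_at j s l)
  * (repeating_in (substr T i j) (take l (drop s.-1 T)) = ~~ unique_at j s l).
Proof.
move=> is_ sl; rewrite /unique_in /repeating_in /occ size_window.
have -> : size (take l (drop s.-1 T)) = l by rewrite size_takel // size_drop; lia.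
set a := (fun p => _); set r := iota _ _.
have sr : s - i \in r by rewrite mem_iota; lia.
have as_ : a (s - i).
  rewrite /a occurrence_eq //; apply/andP; split; first by lia.
  exact/occurs_atP.
have cE : (count a r == 1) = unique_at j s l.
  apply/(count_eq1P _ _ _ _ (iota_uniq _ _) sr as_)/unique_atP => H p.
    move=> ip pl o; suff: p - i = s - i by lia.
    apply: H; first by rewrite mem_iota; lia.
    by rewrite /a occurrence_eq // o andbT; lia.
  rewrite mem_iota /a => pr /andP[pl].
  have {1}-> : p = (p + i) - i by lia.
  rewrite occurrence_eq //; try lia.
  by move=> /(H _ (leq_addl _ _)) h; rewrite -h; lia.
split; first exact: cE.
(* The factor occurs at its own position, so a count other than 1 is at least 2. *)
have c0 : 0 < count a r by rewrite -has_count; apply/hasP; exists (s - i).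
by rewrite -cE; lia.
Qed.

Lemma isMUSE s t : isMUS T i j s t = minimal_unique j s t.
Proof.
rewrite /isMUS /minimal_unique.
case is_ : (i <= s) => //=; case st : (s <= t) => //=; case tj : (t <= j) => //=.
rewrite /substr -/(substr T i j) unique_inE //; last by lia.
congr andb; rewrite /proper_subs_repeating.
set w := take _ _.
have sw : size w = t.+1 - s by rewrite size_takel // size_drop; lia.
have factorE k l : k + l <= size w ->
    take l (drop k w) = take l (drop (s + k).-1 T).
  move=> kl; rewrite /w drop_take take_takel; last by lia.
  by rewrite drop_drop; congr (take _ (drop _ _)); lia.
apply/forallP/andP => [H|[n1 n2] k].
  have properE k : k <= 1 -> ~~ unique_at j (s + k) (t - s).
    move=> k1; have kw : k < (size w).+1 by lia.
    have lw : t - s < (size w).+1 by lia.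
    have /forallP/(_ (Ordinal lw)) := H (Ordinal kw); rewrite /=.
    rewrite factorE; last by lia.
    rewrite unique_inE; try lia.
    move/implyP; apply; apply/eqP => /(congr1 size).
    by rewrite sw size_takel ?size_drop; lia.
  by have := properE 0 isT; have := properE 1 isT; rewrite addn0 addn1 => -> ->.
apply/forallP => l; apply/implyP => neq.
have kw := ltn_ord k; have lw := ltn_ord l.
(* The bound [l] may run past the end of [w]; the minimum is the true length. *)
have tE : take l (drop k w) = take (minn l (size w - k)) (drop k w).
  case: (leqP l (size w - k)) => // lk.
  by rewrite !take_oversize // size_drop; lia.
move: neq; rewrite tE factorE; last by lia.
rewrite unique_inE; try lia.
(* A proper factor at offset 0 misses the last letter of [w]; one at a positive offset misses the
   first. *)
move=> neq; case: (posnP k) => [k0|k0].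
  move: neq; rewrite k0 addn0 subn0 => neq; apply: contra n1.
  have : minn l (size w) != size w.
    by apply: contra neq => /eqP->; rewrite /w -/w sw.
  by move=> ?; apply: unique_at_mono; lia.
by apply: contra n2; apply: unique_at_mono; lia.
Qed.

End Window.

(** * Counting added and deleted MUSs *)

Section Extension.

Variable j : nat.
Hypotheses (i_gt0 : 0 < i) (ij : i <= j) (jT : j < size T).

Let added := MUS T i j.+1 :\: MUS T i j.
Let deleted := MUS T i j :\: MUS T i j.+1.

Lemma mem_MUS p : (p \in MUS T i j = minimal_unique j p.1 p.2)
  * (p \in MUS T i j.+1 = minimal_unique j.+1 p.1 p.2).
Proof. by split; rewrite inE isMUSE //; lia. Qed.

Lemma mem_deleted p : p \in deleted =
  minimal_unique j p.1 p.2 && ~~ minimal_unique j.+1 p.1 p.2.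
Proof. by rewrite inE !mem_MUS andbC. Qed.

Lemma mem_added p : p \in added =
  minimal_unique j.+1 p.1 p.2 && ~~ minimal_unique j p.1 p.2.
Proof. by rewrite inE !mem_MUS andbC. Qed.

Lemma card_deleted : #|deleted| <= 1.
Proof.
apply/card_le1_eqP => -[s t] [s' t']; rewrite !mem_deleted /=.
move=> /andP[m n] /andP[m' n'].
have nu := deleted_not_unique _ _ _ m n.
have nu' := deleted_not_unique _ _ _ m' n'.
have tt : t = t' :> nat.
  move: (m) (m') => /minimal_uniqueP[[? ? ?] u _ _].
  move=> /minimal_uniqueP[[? ? ?] u' _ _].
  have := collapsed_same_end j s (t.+1 - s) s' (t'.+1 - s').
  by move=> /(_ u nu _ _ u' nu'); lia.
have ss : s = s' :> nat by apply: minimal_unique_inj m _; rewrite tt.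
by congr pair; apply: val_inj.
Qed.

(** Added intervals are minimal in the extended window, where the end determines the interval. *)
Lemma card_added_ends (r : seq nat) :
  (forall p, p \in added -> val p.2 \in r) -> #|added| <= size r.
Proof.
move=> H; rewrite cardE -(size_map (fun p => val p.2)); apply: uniq_leq_size.
  rewrite map_inj_in_uniq ?enum_uniq // => -[s t] [s' t'].
  rewrite !mem_enum !mem_added /= => /andP[m _] /andP[m' _] tt.
  congr pair; apply: val_inj => //.
  by apply: minimal_unique_inj m _; rewrite tt.
by move=> x /mapP[p]; rewrite mem_enum => /H ? ->.
Qed.

Lemma card_added_deleted0 : deleted = set0 -> #|added| <= 1.
Proof.
move=> d0; apply: (card_added_ends [:: j.+1]) => -[s t].
rewrite mem_added /= inE => /andP[m n]; apply: contraT => tj.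
have {}tj : t <= j by case/minimal_uniqueP: m => [[? ? ?] _ _ _]; lia.
have [s' [l' [? ? u' nu']]] := added_collapsed _ _ _ tj m n.
have [|//||s0 [t0 H]] := collapsed_deleted j s' l' _ _ _ u' nu'; try lia.
have [/minimal_uniqueP[[? ? ?] _ _ _] _] := andP H.
have s0T : s0 < (size T).+1 by lia.
have t0T : t0 < (size T).+1 by lia.
have := mem_deleted (Ordinal s0T, Ordinal t0T).
by rewrite d0 inE /= H.
Qed.

Lemma card_added : #|added| <= 3.
Proof.
case: (set_0Vmem deleted) => [/card_added_deleted0 h|[[s0 t0]]].
  exact: leq_trans h _.
rewrite mem_deleted /= => /andP[m0 n0].
apply: (card_added_ends [:: j.+1; val t0; (val t0).+1]) => -[s t].
rewrite mem_added /= => /andP[m n].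
by rewrite !inE (added_end _ _ _ _ _ m0 n0 m n).
Qed.

(** With [a] added and [d] deleted, [d <= 1], [a <= 3], and [a <= 1] when [d = 0]; all the bounds on
    [a + d] and [a - d] follow. *)
Lemma MUS_change_bounds :
  #|symdiff (MUS T i j.+1) (MUS T i j)| <= 4 /\
  #|MUS T i j| <= #|MUS T i j.+1| + 1 /\ #|MUS T i j.+1| <= #|MUS T i j| + 2.
Proof.
have := card_setD_balance _ (MUS T i j.+1) (MUS T i j).
rewrite card_symdiff -/added -/deleted.
have := card_added; have := card_deleted; have := card_added_deleted0.
by case: (posnP #|deleted|) => d0 h; [have := h (cards0_eq d0) | clear h]; lia.
Qed.

(** Three additions force a deletion, so a single word attains both upper bounds at once. *)
Lemma MUS_change_of_three_added : 2 < #|added| ->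
  #|symdiff (MUS T i j.+1) (MUS T i j)| = 4 /\ #|MUS T i j.+1| = #|MUS T i j| + 2.
Proof.
move=> a2; have := card_setD_balance _ (MUS T i j.+1) (MUS T i j).
rewrite card_symdiff -/added -/deleted.
have := card_added; have := card_deleted; have := card_added_deleted0.
by case: (posnP #|deleted|) => d0 h; [have := h (cards0_eq d0) | clear h]; lia.
Qed.

(** Once an MUS is deleted, [added_end] leaves three possible ends for an added one; excluding these
    leaves one deletion and no addition. *)
Lemma MUS_change_of_deleted s0 t0 :
  minimal_unique j s0 t0 -> ~~ minimal_unique j.+1 s0 t0 ->
  (forall s t, minimal_unique j.+1 s t -> [|| t == j.+1, t == t0 | t == t0.+1] ->
     minimal_unique j s t) ->
  #|MUS T i j| = #|MUS T i j.+1| + 1.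
Proof.
move=> m0 n0 H; have := card_deleted.
have := card_setD_balance _ (MUS T i j.+1) (MUS T i j).
rewrite -/added -/deleted.
have a0 : #|added| = 0.
  apply/eqP; rewrite cards_eq0; apply/eqP/setP => -[s t]; rewrite mem_added inE /=.
  apply/negP => /andP[m n].
  by move/negP: (n); apply; apply: H m (added_end _ _ _ _ _ m0 n0 m n).
have [[? ? ?] _ _ _] := minimal_uniqueP _ _ _ m0.
have s0T : s0 < (size T).+1 by lia.
have t0T : t0 < (size T).+1 by lia.
have : 0 < #|deleted|.
  by apply/card_gt0P; exists (Ordinal s0T, Ordinal t0T); rewrite mem_deleted m0.
by lia.
Qed.

Lemma three_added s1 t1 s2 t2 s3 t3 : t1 < t2 -> t2 < t3 ->
  minimal_unique j.+1 s1 t1 -> ~~ minimal_unique j s1 t1 ->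
  minimal_unique j.+1 s2 t2 -> ~~ minimal_unique j s2 t2 ->
  minimal_unique j.+1 s3 t3 -> ~~ minimal_unique j s3 t3 ->
  2 < #|added|.
Proof.
move=> t12 t23 m1 n1 m2 n2 m3 n3.
have in_added s t : minimal_unique j.+1 s t -> ~~ minimal_unique j s t ->
    exists2 p, p \in added & val p.2 = t.
  move=> m n; have [[? ? ?] _ _ _] := minimal_uniqueP _ _ _ m.
  have sT : s < (size T).+1 by lia.
  have tT : t < (size T).+1 by lia.
  by exists (Ordinal sT, Ordinal tT); rewrite // mem_added m.
have [p1 a1 e1] := in_added _ _ m1 n1.
have [p2 a2 e2] := in_added _ _ m2 n2.
have [p3 a3 e3] := in_added _ _ m3 n3.
rewrite cardE; apply: (@uniq_leq_size _ [:: p1; p2; p3]).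
  apply: (@map_uniq _ _ (fun p => val p.2)) => /=; rewrite e1 e2 e3 !inE.
  by lia.
by move=> p; rewrite mem_enum !in_cons orbF => /or3P[] /eqP->.
Qed.

End Extension.

End UniqueIntervals.

Arguments letter {A}.
Arguments occurs_at {A}.
Arguments unique_at {A}.
Arguments minimal_unique {A}.

(** * Words coded by natural numbers *)

Section Coded.

Variables (A : finType) (x0 : A).
Hypothesis A_ge3 : 2 < #|A|.

(** Ranks in [enum A] name the letters; [k.+1] makes [f] take positions counted from 1. *)
Definition coded (f : nat -> nat) n : seq A :=
  mkseq (fun k => nth x0 (enum A) (f k.+1)) n.

Variables (f : nat -> nat) (i n : nat).
Hypotheses (f_le2 : forall k, f k <= 2) (i_gt0 : 0 < i).

Lemma size_coded : size (coded f n) = n.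
Proof. exact: size_mkseq. Qed.

Lemma occurs_at_codedP p s l : 0 < p -> 0 < s -> p + l <= n.+1 -> s + l <= n.+1 ->
  reflect (forall k, k < l -> f (p + k) = f (s + k))
          (occurs_at x0 (coded f n) p s l).
Proof.
move=> p0 s0 pl sl.
have letterE q k : 0 < q -> q + l <= n.+1 -> k < l ->
    letter x0 (coded f n) (q + k) = nth x0 (enum A) (f (q + k)).
  move=> *; rewrite /letter nth_mkseq; last by lia.
  by congr (nth _ _ (f _)); lia.
(* Codes stay below the alphabet size, so distinct codes name distinct letters. *)
have fA k : f k < size (enum A) by rewrite -cardE; apply: leq_ltn_trans A_ge3.
apply: (iffP (occurs_atP _ _ _ _ _ _)) => H k kl.
  have := H k kl; rewrite !letterE // => /eqP.
  by rewrite nth_uniq ?enum_uniq // => /eqP.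
by rewrite !letterE // H.
Qed.

Lemma unique_at_coded1 j s : j <= n -> 0 < s <= j ->
  (forall p, i <= p <= j -> f p = f s -> p = s) ->
  unique_at x0 (coded f n) i j s 1.
Proof.
move=> jn sj H; apply/unique_atP => p ip pj /occurs_at_codedP o.
apply: H; first by lia.
by have := o _ _ _ _ 0 isT; rewrite !addn0; apply; lia.
Qed.

Lemma unique_at_coded2 j s : j <= n -> 0 < s < j ->
  (forall p, i <= p < j -> f p = f s -> f p.+1 = f s.+1 -> p = s) ->
  unique_at x0 (coded f n) i j s 2.
Proof.
move=> jn sj H; apply/unique_atP => p ip pj /occurs_at_codedP o.
have {}o k : k < 2 -> f (p + k) = f (s + k) by apply: o; lia.
have := o 0 isT; have := o 1 isT; rewrite !addn0 !addn1 => *.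
by apply: H => //; lia.
Qed.

Lemma not_unique_at_coded p j s l : j <= n -> 0 < s -> s + l <= j.+1 ->
  i <= p -> p + l <= j.+1 -> p <> s -> (forall k, k < l -> f (p + k) = f (s + k)) ->
  ~~ unique_at x0 (coded f n) i j s l.
Proof.
move=> jn s0 sl ip pl ps H; apply/negP => /unique_atP u; apply: ps; apply: u => //.
by apply/occurs_at_codedP => //; lia.
Qed.

(** The positions [p] and [q] repeat the first and the second letter, so neither letter alone is
    unique. *)
Lemma minimal_unique_coded2 p q j s : j <= n -> i <= s < j ->
  (forall r, i <= r < j -> f r = f s -> f r.+1 = f s.+1 -> r = s) ->
  i <= p <= j -> p <> s -> f p = f s ->
  i <= q <= j -> q <> s.+1 -> f q = f s.+1 ->
  minimal_unique x0 (coded f n) i j s s.+1.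
Proof.
move=> jn sj H pj ps fp qj qs fq; apply/minimal_uniqueP.
have -> : s.+2 - s = 2 by lia.
have -> : s.+1 - s = 1 by lia.
split; first by split; lia.
- by apply: unique_at_coded2 => //; lia.
- apply: (not_unique_at_coded p) => //; try lia.
  by case=> // _; rewrite !addn0.
- apply: (not_unique_at_coded q) => //; try lia.
  by case=> // _; rewrite !addn0.
Qed.

End Coded.

(** * Words attaining the bounds *)

Section Tightness.

Variables (A : finType) (x0 : A) (n i j : nat).
Hypotheses (A_ge3 : 2 < #|A|) (i_gt0 : 0 < i) (jn : j < n) (ij : i + 4 <= j).

(* The window a^p b c c extended by b, with a, b, c coded as 0, 1, 2. *)
Definition gain_word k :=
  if k < j - 2 then 0 else if k == j - 2 then 1 else if k <= j then 2 else 1.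

(* The window a b b c^p a extended by b. *)
Definition loss_word k :=
  if k <= i then 0 else if k <= i + 2 then 1 else if k < j then 2 else
  if k == j then 0 else 1.

Lemma gain_wordP k :
  gain_word k = 0 /\ k < j - 2 \/
  gain_word k = 1 /\ (k = j - 2 \/ j < k) \/ gain_word k = 2 /\ j - 2 < k <= j.
Proof. by rewrite /gain_word; do !case: ifP; lia. Qed.

Lemma loss_wordP k :
  loss_word k = 0 /\ (k <= i \/ k = j) \/
  loss_word k = 1 /\ (i < k <= i + 2 \/ j < k) \/
  loss_word k = 2 /\ i + 2 < k < j.
Proof. by rewrite /loss_word; do !case: ifP; lia. Qed.

Lemma gain_word_le2 k : gain_word k <= 2.
Proof. by have := gain_wordP k; lia. Qed.

Lemma loss_word_le2 k : loss_word k <= 2.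
Proof. by have := loss_wordP k; lia. Qed.

(** The unique b of the old window prevents every longer interval through it from being minimal; the
    appended b lifts this obstruction. *)
Lemma gain_three_added : let T := coded A x0 gain_word n in
  2 < #|MUS T i j.+1 :\: MUS T i j|.
Proof.
have w0 : gain_word i = 0 by have := gain_wordP i; lia.
have w1 : gain_word (j - 3) = 0 by have := gain_wordP (j - 3); lia.
have w2 : gain_word (j - 2) = 1 by have := gain_wordP (j - 2); lia.
have w3 : gain_word j.-1 = 2 by have := gain_wordP j.-1; lia.
have w4 : gain_word j = 2 by have := gain_wordP j; lia.
have w5 : gain_word j.+1 = 1 by have := gain_wordP j.+1; lia.
have e2 : (j - 3).+1 = j - 2 by lia.
have e3 : (j - 2).+1 = j.-1 by lia.
have b_unique : unique_at x0 (coded A x0 gain_word n) i j (j - 2) 1.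
  apply: (unique_at_coded1 _ _ A_ge3 _ _ _ gain_word_le2) => //; try lia.
  by move=> p; have := gain_wordP p; lia.
have not_minimal s t : s <= j - 2 <= t -> s < t ->
    ~~ minimal_unique x0 (coded A x0 gain_word n) i j s t.
  move=> st lt; apply/negP => /minimal_uniqueP[[? ? ?] _ n1 n2].
  (* An interval ending at the b still contains it after losing its first letter, any other after
     losing its last. *)
  have [e|ne] := eqVneq t (j - 2).
    by case/negP: n2; apply: unique_at_mono b_unique; lia.
  by case/negP: n1; apply: unique_at_mono b_unique; lia.
apply: (three_added _ x0 _ _ _ i_gt0 _ _ (j - 3) (j - 3).+1 (j - 2) (j - 2).+1 j j.+1);
  rewrite ?size_coded //; try lia.
(* The interval ab, whose letters recur at [i] and [j.+1]; then come bc and cb in the same way. *)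
- by apply: (minimal_unique_coded2 _ _ A_ge3 _ _ _ gain_word_le2 i_gt0 i j.+1);
    rewrite ?e2 ?e3; try lia;
    move=> p; have := gain_wordP p; have := gain_wordP p.+1; lia.
- by apply: not_minimal; lia.
- by apply: (minimal_unique_coded2 _ _ A_ge3 _ _ _ gain_word_le2 i_gt0 j.+1 j);
    rewrite ?e2 ?e3; try lia;
    move=> p; have := gain_wordP p; have := gain_wordP p.+1; lia.
- by apply: not_minimal; lia.
- by apply: (minimal_unique_coded2 _ _ A_ge3 _ _ _ gain_word_le2 i_gt0 j.-1 (j - 2));
    rewrite ?e2 ?e3; try lia;
    move=> p; have := gain_wordP p; have := gain_wordP p.+1; lia.
- by apply/negP => /minimal_uniqueP[[? ? ?] _ _ _]; lia.
Qed.

(** The second ab, at [j], deletes the first; the factors ca and bb, still unique, keep new MUSs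
    away from the possible ends. *)
Lemma loss_MUS_card : let T := coded A x0 loss_word n in
  #|MUS T i j| = #|MUS T i j.+1| + 1.
Proof.
set T := coded _ _ _ _ => /=.
have w0 : loss_word i = 0 by have := loss_wordP i; lia.
have w1 : loss_word i.+1 = 1 by have := loss_wordP i.+1; lia.
have w2 : loss_word i.+2 = 1 by have := loss_wordP i.+2; lia.
have w3 : loss_word j.-1 = 2 by have := loss_wordP j.-1; lia.
have w4 : loss_word j = 0 by have := loss_wordP j; lia.
have w5 : loss_word j.+1 = 1 by have := loss_wordP j.+1; lia.
have ab_repeats : ~~ unique_at x0 T i j.+1 i 2.
  apply: (not_unique_at_coded _ _ A_ge3 _ _ _ loss_word_le2 i_gt0 j) => //; try lia.
  by case=> [|[|]] // _; rewrite ?addn0 ?addn1; lia.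
have ab_repeats' : ~~ unique_at x0 T i j.+1 j 2.
  apply: (not_unique_at_coded _ _ A_ge3 _ _ _ loss_word_le2 i_gt0 i) => //; try lia.
  by case=> [|[|]] // _; rewrite ?addn0 ?addn1; lia.
have ca_unique : unique_at x0 T i j.+1 j.-1 2.
  by apply: (unique_at_coded2 _ _ A_ge3 _ _ _ loss_word_le2) => //;
    rewrite ?prednK; try lia;
    move=> p; have := loss_wordP p; have := loss_wordP p.+1; lia.
have bb_unique : unique_at x0 T i j.+1 i.+1 2.
  by apply: (unique_at_coded2 _ _ A_ge3 _ _ _ loss_word_le2) => //; try lia;
    move=> p; have := loss_wordP p; have := loss_wordP p.+1; lia.
have ab_minimal : minimal_unique x0 T i j i i.+1.
  by apply: (minimal_unique_coded2 _ _ A_ge3 _ _ _ loss_word_le2 i_gt0 j i.+2);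
    try lia; move=> p; have := loss_wordP p; have := loss_wordP p.+1; lia.
have bb_minimal : minimal_unique x0 T i j i.+1 i.+2.
  by apply: (minimal_unique_coded2 _ _ A_ge3 _ _ _ loss_word_le2 i_gt0 i.+2 i.+1);
    try lia; move=> p; have := loss_wordP p; have := loss_wordP p.+1; lia.
apply: (MUS_change_of_deleted _ x0 _ _ _ i_gt0 _ _ _ _ ab_minimal);
  rewrite ?size_coded //; try lia.
  apply/negP => /minimal_uniqueP[_ u _ _]; case/negP: ab_repeats.
  by have -> : 2 = i.+2 - i by lia.
move=> s t /minimal_uniqueP[[is_ st tj] u n1 n2] /or3P[] /eqP et; subst t.
(* End [j.+1]: the interval contains ca before its last letter, or lies in the repeated ab. *)
- have [sj|sj] := leqP s j.-1.
    by case/negP: n1; apply: unique_at_mono ca_unique; lia.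
  by case/negP: ab_repeats'; apply: unique_at_mono u; lia.
- by case/negP: ab_repeats; apply: unique_at_mono u; lia.
(* End [i.+2]: a longer interval contains bb, bb itself was already minimal, and b alone repeats. *)
- have [si|si] := leqP s i.
    by case/negP: n2; apply: unique_at_mono bb_unique; lia.
  have [->//|si'] := eqVneq s i.+1.
  suff /negP[] : ~~ unique_at x0 T i j.+1 i.+2 1.
    by apply: unique_at_mono u; lia.
  apply: (not_unique_at_coded _ _ A_ge3 _ _ _ loss_word_le2 i_gt0 i.+1) => //; try lia.
  by case=> // _; rewrite !addn0; lia.
Qed.

End Tightness.

Theorem theorem1 :
  (forall (sigma : nat) (Sigma : finType), #|Sigma| = sigma -> 2 <= sigma ->
   forall (n : nat) (T : seq Sigma), size T = n ->
   forall i j : nat, 1 <= i -> i <= j -> j < n ->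
     #|symdiff (MUS T i j.+1) (MUS T i j)| <= 4 /\
     ((-1 <= (#|MUS T i j.+1|%:Z - #|MUS T i j|%:Z))%R /\
      ((#|MUS T i j.+1|%:Z - #|MUS T i j|%:Z) <= 2)%R))
  /\
  (forall (sigma : nat) (Sigma : finType), #|Sigma| = sigma -> 3 <= sigma ->
   forall n i j : nat, 1 <= i -> i <= j -> j < n -> 5 <= j - i + 1 ->
     (exists T : seq Sigma, size T = n /\
        #|symdiff (MUS T i j.+1) (MUS T i j)| = 4) /\
     (exists T : seq Sigma, size T = n /\
        (#|MUS T i j.+1|%:Z - #|MUS T i j|%:Z = 2)%R) /\
     (exists T : seq Sigma, size T = n /\
        (#|MUS T i j.+1|%:Z - #|MUS T i j|%:Z = -1)%R)).
Proof.
split=> [_ A _ _ n T sT i j i0 ij jn | _ A <- A3 n i j i0 ij jn ij5].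
  (* The text is nonempty because [j < n], which supplies a default letter. *)
  have [x0 _] : exists x0, x0 \in T.
    case: T sT => [n0|x T _]; first by rewrite -n0 in jn.
    by exists x; rewrite mem_head.
  have jT : j < size T by lia.
  have [? [? ?]] := MUS_change_bounds _ x0 T i j i0 ij jT.
  by split=> //; lia.
have [x0 _] : exists x0, x0 \in A by apply/card_gt0P; apply: ltn_trans A3.
have ij4 : i + 4 <= j by lia.
have jT f : j < size (coded A x0 f n) by rewrite size_coded.
have [g4 g2] := MUS_change_of_three_added _ x0 _ _ _ i0 ij (jT _)
  (gain_three_added _ x0 _ _ _ A3 i0 jn ij4).
have l1 := loss_MUS_card _ x0 _ _ _ A3 i0 jn ij4.
split; last split.
- by exists (coded A x0 (gain_word j) n); split; first exact: size_coded.
- by exists (coded A x0 (gain_word j) n); split; [exact: size_coded | lia].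
- by exists (coded A x0 (loss_word i j) n); split; [exact: size_coded | lia].
Qed.
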